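(* Let $1\le p<q<\infty$. Then there exists no weakly sequentially continuous map $\ell_q\to\ell_p$ which is coarse and satisfies Property $( * )$. In particular, the existence of a weakly sequentially continuous coarse (resp. uniform) embedding between Banach spaces is strictly stronger than coarse (resp. uniform) embeddability: there exist Banach spaces $X$ and $Y$ such that $X$ coarsely (resp. uniformly) embeds into $Y$, but there is no coarse (resp. uniform) embedding $X\to Y$ which is weakly sequentially continuous.
   Context: For a map $f:X\to Y$ between Banach spaces (not assumed linear) let $\omega_f(t)=\sup\{\|f(x)-f(y)\| : \|x-y\|\le t\}$ and $\rho_f(t)=\inf\{\|f(x)-f(y)\| : \|x-y\|\ge t\}$ for $t\ge 0$. The map $f$ is coarse if $\omega_f(t)<\infty$ for all $t\ge 0$; it is a coarse embedding if it is coarse and $\lim_{t\to\infty}\rho_f(t)=\infty$; it is a uniform embedding if $\lim_{t\to 0^+}\omega_f(t)=0$ and $\rho_f(t)>0$ for all $t>0$. It satisfies Property $( * )$ if there exist $\beta>\alpha>0$ such that $\inf_{\|x-y\|\in[\alpha,\beta]}\|f(x)-f(y)\|>0$. It is weakly sequentially continuous if $x_n\to x$ weakly in $X$ implies $f(x_n)\to f(x)$ weakly in $Y$. *)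

(* Defs.v *)
From HB Require Import structures.
From mathcomp Require Import all_boot all_order all_algebra.
From mathcomp Require Import all_classical all_reals all_analysis.
Set Implicit Arguments.
Unset Strict Implicit.
Unset Printing Implicit Defensive.
Import Order.TTheory GRing.Theory Num.Theory.
Import numFieldNormedType.Exports.
Local Open Scope classical_set_scope.
Local Open Scope ring_scope.

(* Every set of naturals is measurable, so the elements of [LfunType] over the
   counting measure of [nat] are exactly the p-summable real sequences; no
   quotient is needed since only the empty set is negligible. *)
Definition ell (R : realType) (p : R) (p1 : 1 <= p) : Type :=
  LfunType (@counting nat R) (p1 : (1 <= p%:E)%E).

Section ell_space.
Variables (R : realType) (p : R) (p1 : 1 <= p).
Local Notation lp := (ell p1).

Definition ell_seq (x : lp) : nat -> R :=
  (x : LfunType (@counting nat R) (p1 : (1 <= p%:E)%E)).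
Coercion ell_seq : ell >-> Funclass.

HB.instance Definition _ := GRing.Lmodule.copy lp
  (LfunType (@counting nat R) (p1 : (1 <= p%:E)%E)).

Definition ell_norm (x : lp) : R := fine ('N[@counting nat R]_p%:E[EFin \o x])%E.

Lemma ell_exp_gt0 : 0 < p. Proof. exact: lt_le_trans p1. Qed.

Lemma ell_norm_sum (x : lp) :
  ((ell_norm x)%:E = (\sum_(k <oo) (`|x k| `^ p)%:E) `^ p^-1)%E.
Proof. by rewrite /ell_norm finite_norm_fine Lnorm_counting ?ell_exp_gt0. Qed.

Lemma ell_eqP (x y : lp) : x = y <-> x =1 y.
Proof. exact: LfuneqP. Qed.

Lemma ell_normD (x y : lp) : ell_norm (x + y) <= ell_norm x + ell_norm y.
Proof. exact: ler_LnormD. Qed.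

Lemma ell_normZ (a : R) (x : lp) : ell_norm (a *: x) = `|a| * ell_norm x.
Proof.
apply: EFin_inj; rewrite EFinM !finite_norm_fine.
exact: LnormZ.
Qed.

Lemma ell_term_le (x : lp) k : `|x k| <= ell_norm x.
Proof.
have p0 := ell_exp_gt0.
have pos i : (0 <= (`|x i| `^ p)%:E)%E by rewrite lee_fin powR_ge0.
have h : ((`|x k| `^ p)%:E <= \sum_(i <oo) (`|x i| `^ p)%:E)%E.
  apply: (@le_trans _ _ (\sum_(0 <= i < k.+1) (`|x i| `^ p)%:E)%E).
    by rewrite big_nat_recr//= leeDr// sume_ge0.
  exact: nneseries_lim_ge.
rewrite -lee_fin ell_norm_sum.
have -> : (`|x k|%:E = ((`|x k| `^ p)%:E `^ p^-1))%E.
  by rewrite poweR_EFin -powRrM mulfV ?gt_eqF// powRr1.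
apply: gt0_ler_poweR => //; first by rewrite invr_ge0 ltW.
- by rewrite in_itv/= leey andbT lee_fin powR_ge0.
- by rewrite in_itv/= leey andbT nneseries_ge0// => *; rewrite lee_fin powR_ge0.
Qed.

Lemma ell_norm0_eq0 (x : lp) : ell_norm x = 0 -> x = 0.
Proof.
move=> x0; apply/ell_eqP => k; apply/eqP.
by rewrite -[_ == _]normr_le0 -x0 ell_term_le.
Qed.

HB.instance Definition _ :=
  Lmodule_isNormed.Build R lp ell_normD ell_normZ ell_norm0_eq0.

Lemma ell_normE (x : lp) :
  (`|x|%:E = (\sum_(k <oo) (`|x k| `^ p)%:E) `^ p^-1)%E.
Proof. exact: ell_norm_sum. Qed.

Lemma ell_coord_le (x : lp) k : `|x k| <= `|x|.
Proof. exact: ell_term_le. Qed.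

Lemma ell_ex (u : nat -> R) : (\sum_(k <oo) (`|u k| `^ p)%:E < +oo)%E ->
  exists x : lp, x =1 u.
Proof.
move=> h.
have hu : u \in Lfun (@counting nat R) p%:E.
  apply/andP; split; first by rewrite inE.
  rewrite inE/= /finite_norm Lnorm_counting ?ell_exp_gt0//.
  exact: poweR_lty.
by exists (Lfun_Sub (p1 : (1 <= p%:E)%E) hu).
Qed.

Lemma ell_partial (u : nat -> R) (e : R) : 0 <= e ->
  (forall n, \sum_(0 <= k < n) `|u k| `^ p <= e `^ p) ->
  exists2 x : lp, x =1 u & `|x| <= e.
Proof.
move=> e0 h; have p0 := ell_exp_gt0.
have pos k : (0 <= (`|u k| `^ p)%:E)%E by rewrite lee_fin powR_ge0.
have hs : (\sum_(k <oo) (`|u k| `^ p)%:E <= (e `^ p)%:E)%E.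
  apply: lime_le; first exact: is_cvg_nneseries.
  by apply: nearW => n; rewrite sumEFin lee_fin.
have [x xu] := ell_ex (le_lt_trans hs (ltry _)).
exists x => //; rewrite -lee_fin ell_normE.
have -> : (e%:E = ((e `^ p)%:E `^ p^-1))%E.
  by rewrite poweR_EFin -powRrM mulfV ?gt_eqF// powRr1.
under eq_eseriesr do rewrite xu.
apply: gt0_ler_poweR => //; first by rewrite invr_ge0 ltW.
- by rewrite in_itv/= leey andbT nneseries_ge0.
- by rewrite in_itv/= leey andbT lee_fin powR_ge0.
Qed.

Lemma ell_norm_partial (x : lp) n :
  \sum_(0 <= k < n) `|x k| `^ p <= `|x| `^ p.
Proof.
have p0 := ell_exp_gt0.
have pos k : (0 <= (`|x k| `^ p)%:E)%E by rewrite lee_fin powR_ge0.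
have -> : `|x| `^ p = fine (\sum_(k <oo) (`|x k| `^ p)%:E)%E.
  rewrite -[`|x|]/(fine `|x|%:E) ell_normE fine_poweR -powRrM.
  by rewrite mulVf ?gt_eqF// powRr1// fine_ge0// nneseries_ge0.
have fin : (\sum_(k <oo) (`|x k| `^ p)%:E)%E \is a fin_num.
  rewrite ge0_fin_numE; last exact: nneseries_ge0.
  apply: (@lty_poweRy _ _ p^-1); first by rewrite invr_neq0// gt_eqF.
  by rewrite -ell_normE ltry.
by rewrite -lee_fin fineK// -sumEFin; apply: nneseries_lim_ge.
Qed.

Lemma continuous_norm_powR : continuous (fun r : R => `|r| `^ p).
Proof.
have p0 := ell_exp_gt0; move=> a; have [->|a0] := eqVneq a 0.
  apply/cvgrPdist_le => e e0; rewrite normr0 powR0 ?gt_eqF//.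
  near=> r; rewrite sub0r normrN ger0_norm ?powR_ge0//.
  rewrite -[leRHS]powRr1 ?(ltW e0)// -(@mulVf _ p) ?gt_eqF// powRrM.
  apply: ge0_ler_powR; rewrite ?nnegrE ?powR_ge0 ?(ltW p0)//.
  near: r; have d0 : 0 < e `^ p^-1 by rewrite powR_gt0.
  have /cvgrPdist_le/(_ _ d0) : (r @[r --> (0 : R)] --> (0 : R)) by exact: cvg_id.
  by apply: filterS => r; rewrite sub0r normrN.
have cl : {for a, continuous (fun r : R => ln `|r|)}.
  apply: (@continuous_comp R R R (fun r : R => `|r|) (@ln R)).
    exact: norm_continuous.
  by apply: continuous_ln; rewrite normr_gt0.
have h : expR (p * ln `|r|) @[r --> a] --> expR (p * ln `|a|).
  apply: (@continuous_comp R R R (fun r : R => p * ln `|r|) expR).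
    by apply: cvgM; [exact: cvg_cst|exact: cl].
  exact: continuous_expR.
rewrite /continuous_at [X in _ --> X](_ : _ = expR (p * ln `|a|)); last first.
  by rewrite /powR normr_eq0 (negbTE a0).
apply: cvg_trans h; apply: near_eq_cvg; near=> r.
rewrite /powR normr_eq0 ifF//; apply/negbTE.
by near: r; exact: (cvgr_neq0 a (@cvg_id _ _) a0).
Unshelve. all: by end_near. Qed.

Lemma ell_complete (F : set_system lp) : ProperFilter F -> cauchy F -> cvg F.
Proof.
move=> FF /cauchy_ballP Fc; have p0 := ell_exp_gt0.
have coord k : cvg ((fun x : lp => x k) @ F).
  apply: R_complete; apply/cauchy_ballP => e e0.
  have [[A B] /= [FA FB] AB] := Fc e e0.
  exists ([set x k | x in A], [set x k | x in B]) => /=.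
    by split; [apply: filterS FA|apply: filterS FB] => x; exists x.
  move=> [_ _] /= [[x Ax <-] [y By <-]].
  have := AB (x, y) (conj Ax By).
  rewrite /= -!ball_normE /ball_ /=.
  by apply: le_lt_trans; exact: (ell_coord_le (x - y) k).
pose l k := lim ((fun x : lp => x k) @ F).
have key e : 0 < e -> \forall x \near F,
    exists2 z : lp, z =1 (fun k => (x : lp) k - l k) & `|z| <= e.
  move=> e0; have [[A B] /= [FA FB] AB] := Fc e e0.
  near=> x.
  have Ax : A x by near: x.
  apply: ell_partial; first exact: ltW.
  move=> n.
  have cv : (fun y : lp => \sum_(0 <= k < n) `|x k - y k| `^ p) @ F -->
            \sum_(0 <= k < n) `|x k - l k| `^ p.
    apply: cvg_big => //; first exact: add_continuous.
    move=> k _; apply: (@continuous_cvg _ _ _ _ _ _ (fun r : R => `|r| `^ p)).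
      exact: continuous_norm_powR.
    by apply: cvgB; [exact: cvg_cst|exact: coord].
  rewrite -(cvg_lim _ cv)//.
  apply: limr_le; first by apply/cvg_ex; eexists; exact: cv.
  near=> y.
  have By : B y by near: y.
  apply: (le_trans (ell_norm_partial (x - y) n)).
  apply: ge0_ler_powR; rewrite ?nnegrE ?(ltW p0) ?(ltW e0)//.
  have := AB (x, y) (conj Ax By).
  by rewrite /= -ball_normE => /ltW.
have [x0 [z0 z0E _]] := filter_ex (key 1 ltr01).
pose L : lp := x0 - z0.
have LE k : L k = l k.
  by rewrite -[L k]/(x0 k - z0 k) z0E opprB addrC subrK.
apply/cvg_ex; exists L; apply/cvgrPdist_le => e e0.
apply: filterS (key e e0) => x [z zE ze].
rewrite distrC (_ : x - L = z)//.
by apply/ell_eqP => k; rewrite zE -LE.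
Unshelve. all: by end_near. Qed.

HB.instance Definition _ := Uniform_isComplete.Build lp ell_complete.

End ell_space.

(* The supremum and infimum are taken in the extended reals: an infimum over no
   pair at all (only possible when X is trivial) is +oo. *)
Section nonlinear_maps.
Variables (R : realType) (X Y : normedModType R).
Implicit Type f : X -> Y.

Definition omega f (t : R) : \bar R :=
  ereal_sup [set `|f xy.1 - f xy.2|%:E |
    xy in [set xy : X * X | `|xy.1 - xy.2| <= t]].

Definition rho f (t : R) : \bar R :=
  ereal_inf [set `|f xy.1 - f xy.2|%:E |
    xy in [set xy : X * X | t <= `|xy.1 - xy.2|]].

Definition coarse f := forall t : R, 0 <= t -> (omega f t < +oo)%E.

Definition coarse_embedding f :=
  coarse f /\ (rho f t @[t --> +oo%R] --> +oo%E).

Definition uniform_embedding f :=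
  (omega f t @[t --> 0^'+] --> 0%E) /\ (forall t : R, 0 < t -> (0 < rho f t)%E).

Definition property_star f := exists a b : R, [/\ 0 < a, a < b &
  (0 < ereal_inf [set `|f xy.1 - f xy.2|%:E |
         xy in [set xy : X * X | (a <= `|xy.1 - xy.2| <= b)%R]])%E].

End nonlinear_maps.

Definition weakly_cvg (R : realType) (X : normedModType R) (u : nat -> X) (x : X) :=
  forall phi : {linear X -> R^o}, continuous phi -> phi (u n) @[n --> \oo] --> phi x.

Definition weakly_seq_continuous (R : realType) (X Y : normedModType R) (f : X -> Y) :=
  forall (u : nat -> X) (x : X), weakly_cvg u x -> weakly_cvg (f \o u) (f x).

(* Main.v *)
(** In l_q with q > 1, consider x_k = r (e_{n_1} + ... + e_{n_k}), of norm
    r k^(1/q), with indices chosen greedily; since e_n is weakly null, a weakly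
    sequentially continuous f sends x_k + r e_n to a sequence converging weakly
    to f x_k. If f takes values in l_p and has Property ( * ), each step increases
    |f x_k - f 0|^p by a fixed amount, so |f x_k - f 0| >= c k^(1/p), whereas a
    coarse map is Lipschitz at large distances: impossible when p < q. If f takes
    values in c_0, then |f x_k - f (- x_k)| does not accumulate and stays below
    2 omega_f(r) up to an arbitrarily small error, although |x_k - (- x_k)| is
    as large as desired: this rules out coarse embeddings (r = 1) and uniform
    embeddings (r -> 0). On the other hand every separable normed space, such as
    l_2, embeds bi-Lipschitzly into c_0 (Aharoni). The pair (l_2, c_0) thus serves
    for both the coarse and the uniform existence claims. *)

Require Import Defs.
From HB Require Import structures.
From mathcomp Require Import all_boot all_order all_algebra.
From mathcomp Require Import ring lra.
From mathcomp Require Import all_classical all_reals all_analysis.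
Set Implicit Arguments.
Unset Strict Implicit.
Unset Printing Implicit Defensive.
Import Order.TTheory GRing.Theory Num.Theory.
Import numFieldNormedType.Exports.
Local Open Scope classical_set_scope.
Local Open Scope ring_scope.

(** * The space c_0 over an index type *)

Definition c0_pred (R : realType) (T : pointedType) : {pred T -> R^o} :=
  fun u => `[< forall e : R, 0 < e -> finite_set [set k | e <= `|u k|] >].

Lemma c0_submod_closed (R : realType) (T : pointedType) :
  submod_closed (@c0_pred R T).
Proof.
split.
  apply/asboolP => e e0; rewrite (_ : mkset _ = set0)//.
  by apply/seteqP; split => // k /=; rewrite normr0 leNgt e0.
move=> a u v /asboolP hu /asboolP hv; apply/asboolP => e e0.
have e1 : 0 < e / 2 / (`|a| + 1) by rewrite !divr_gt0 ?ltr_wpDl.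
have e2 : 0 < e / 2 by rewrite divr_gt0.
have := conj (hv _ e2) (hu _ e1); rewrite -finite_setU.
apply: sub_finite_set => k /= ek.
have [|hvk] := leP (e / 2) `|v k|; first by left.
have [|huk] := leP (e / 2 / (`|a| + 1)) `|u k|; first by right.
exfalso.
have : `|a| * `|u k| <= e / 2.
  rewrite -[e / 2](@divfK _ (`|a| + 1)) ?gt_eqF ?ltr_wpDl// mulrC.
  by apply: ler_pM => //; [exact: ltW|rewrite lerDl].
have := ler_normD (a *: u k) (v k); rewrite normrZ => h1 h2.
have : e <= `|a *: u k + v k| := ek.
lra.
Qed.

HB.instance Definition _ (R : realType) (T : pointedType) :=
  GRing.isSubmodClosed.Build R (T -> R^o) (@c0_pred R T)
    (@c0_submod_closed R T).

(* Tending to 0 along the cofinite filter of an arbitrary index type. *)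
Record c0 (R : realType) (T : pointedType) :=
  C0 { c0_fun :> T -> R^o ; c0_funP : c0_fun \in @c0_pred R T }.

Section c0_space.
Variables (R : realType) (T : pointedType).
Local Notation c0 := (c0 R T).
Implicit Types (u v : c0) (k : T).

HB.instance Definition _ := [isSub for @c0_fun R T].
HB.instance Definition _ := [Choice of c0 by <:].
HB.instance Definition _ := [SubChoice_isSubLmodule of c0 by <:].

Lemma c0_eqP u v : u =1 v -> u = v.
Proof. by move=> uv; apply: val_inj; apply: funext. Qed.

Lemma c0_finite u (e : R) : 0 < e -> finite_set [set k | e <= `|u k|].
Proof. by move: e; have := c0_funP u; rewrite unfold_in => /asboolP. Qed.

Lemma c0_ex (u : T -> R) :
  (forall e : R, 0 < e -> finite_set [set k | e <= `|u k|]) ->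
  {v : c0 | v =1 u}.
Proof. by move=> /asboolP uP; exists (@C0 R T u uP). Qed.

Definition c0_norm u : R := sup (range (fun k => `|u k|)).


(** Only finitely many coordinates reach 1 in absolute value; 1 plus the sum of these absolute
    values is an upper bound. *)
Lemma c0_has_sup u : has_sup (range (fun k => `|u k|)).
Proof.
split; first by exists `|u point|, point.
have /finite_seqP[s sE] := c0_finite u ltr01.
exists (1 + \sum_(i <- s) `|u i|) => _ [k _ <-].
have [k1|/ltW k1] := leP 1 `|u k|; last first.
  by apply: (le_trans k1); rewrite lerDl sumr_ge0.
have ks : k \in s by have : [set` s] k by rewrite -sE.
rewrite (big_rem k)//= addrCA lerDl addr_ge0// sumr_ge0//.
Qed.

Lemma c0_norm_ge u k : `|u k| <= c0_norm u.
Proof. by apply: ub_le_sup; [exact: (c0_has_sup u).2|exists k]. Qed.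

Lemma c0_norm_le u (e : R) : (forall k, `|u k| <= e) -> c0_norm u <= e.
Proof.
move=> ue; apply: ge_sup; first exact: (c0_has_sup u).1.
by move=> _ [k _ <-].
Qed.

Lemma c0_normD u v : c0_norm (u + v) <= c0_norm u + c0_norm v.
Proof.
apply: c0_norm_le => k; apply: (le_trans (ler_normD (u k) (v k))).
by apply: lerD; exact: c0_norm_ge.
Qed.

Lemma c0_normZ (a : R) u : c0_norm (a *: u) = `|a| * c0_norm u.
Proof.
have zle b w : c0_norm (b *: w) <= `|b| * c0_norm w.
  apply: c0_norm_le => k; rewrite -[(b *: w) k]/(b *: w k) normrZ.
  by rewrite ler_wpM2l// c0_norm_ge.
apply/eqP; rewrite eq_le zle/=.
have [->|a0] := eqVneq a 0.
  by rewrite normr0 mul0r (le_trans (normr_ge0 _) (c0_norm_ge _ point)).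
rewrite -ler_pdivlMl ?normr_gt0// -normfV.
by apply: le_trans (zle _ _); rewrite scalerA mulVf// scale1r.
Qed.

Lemma c0_norm0_eq0 u : c0_norm u = 0 -> u = 0.
Proof.
move=> u0; apply: c0_eqP => k; apply/eqP.
by rewrite -[_ == _]normr_le0 -u0 c0_norm_ge.
Qed.

HB.instance Definition _ :=
  Lmodule_isNormed.Build R c0 c0_normD c0_normZ c0_norm0_eq0.

Lemma c0_coord_le u k : `|u k| <= `|u|.
Proof. exact: c0_norm_ge. Qed.

(** The Cauchy estimate is uniform in the index, so it passes to the coordinatewise limit. That
    limit is in c_0: where it reaches [e] in absolute value, an approximant within [e / 2] reaches
    [e / 2]. *)
Lemma c0_complete (F : set_system c0) : ProperFilter F -> cauchy F -> cvg F.
Proof.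
move=> FF /cauchy_ballP Fc.
have coord k : cvg ((fun u : c0 => u k) @ F).
  apply: R_complete; apply/cauchy_ballP => e e0.
  have [[A B] /= [FA FB] AB] := Fc e e0.
  exists ([set u k | u in A], [set u k | u in B]) => /=.
    by split; [apply: filterS FA|apply: filterS FB] => u; exists u.
  move=> [_ _] /= [[u Au <-] [v Bv <-]].
  have := AB (u, v) (conj Au Bv).
  rewrite /= -!ball_normE /ball_ /=.
  by apply: le_lt_trans; exact: (c0_coord_le (u - v) k).
pose l k := lim ((fun u : c0 => u k) @ F).
have key e : 0 < e -> \forall u \near F, forall k, `|(u : c0) k - l k| <= e.
  move=> e0; have [[A B] /= [FA FB] AB] := Fc e e0.
  near=> u => k.
  have Au : A u by near: u.
  have cv : (fun v : c0 => `|u k - v k|) @ F --> `|u k - l k|.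
    by apply: cvg_norm; apply: cvgB; [exact: cvg_cst|exact: coord].
  rewrite -(cvg_lim _ cv)//.
  apply: limr_le; first by apply/cvg_ex; eexists; exact: cv.
  near=> v.
  have Bv : B v by near: v.
  apply: le_trans (c0_coord_le (u - v) k) _.
  by have := AB (u, v) (conj Au Bv); rewrite /= -ball_normE => /ltW.
have [|L LE] := @c0_ex l.
  move=> e e0; have e2 : 0 < e / 2 by rewrite divr_gt0.
  have [u uP] := filter_ex (key _ e2).
  apply: sub_finite_set (c0_finite u e2) => k /= ek.
  have := ler_normB (u k) (u k - l k); rewrite subKr.
  have := uP k; move: ek; lra.
apply/cvg_ex; exists L; apply/cvgrPdist_le => e e0.
apply: filterS (key e e0) => u ue.
rewrite distrC; apply: c0_norm_le => k.
by rewrite -[(u - L) k]/(u k - L k) LE.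
Unshelve. all: by end_near. Qed.

HB.instance Definition _ := Uniform_isComplete.Build c0 c0_complete.

End c0_space.

(** * Aharoni's embedding into c_0 *)

Section aharoni.
Variables (R : realType) (X : normedModType R) (a : nat -> X).
Hypotheses (a0 : a 0%N = 0)
  (a_dense : forall (x : X) (e : R), 0 < e -> exists n, `|x - a n| <= e).
Implicit Types (r : R) (x y : X).

(* Supported in the ball of radius 3r around [a n] but outside the balls of
   radius r around the earlier points, so that only finitely many of these
   functions are nonzero at a given point. *)
Definition bump r (n : nat) x : R :=
  Num.max 0 (Num.min (3 * r - `|x - a n|)
    (\big[Num.min/r]_(m < n) (`|x - a m| - r))).

Lemma bump_ge0 r n x : 0 <= bump r n x.
Proof. by rewrite le_max lexx. Qed.

Lemma bump_le r n x : 0 <= r -> bump r n x <= r.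
Proof. by move=> r0; rewrite ge_max r0 ge_min bigmin_le_id orbT. Qed.

Lemma bump_lip1 r n x y : 0 <= r -> bump r n x <= bump r n y + `|x - y|.
Proof.
move=> r0; have d0 := normr_ge0 (x - y).
have h m : `|x - a m| <= `|x - y| + `|y - a m| by exact: ler_distD.
have h' m : `|y - a m| <= `|x - y| + `|x - a m|.
  by rewrite [`|x - y|]distrC ler_distD.
rewrite {1}/bump ge_max addr_ge0 ?bump_ge0//=.
rewrite -lerBlDr le_max le_min; apply/orP; right; apply/andP; split.
  by rewrite lerBlDr ge_min; apply/orP; left; have := h' n; lra.
apply: le_bigmin => [|m _]; rewrite lerBlDr ge_min; apply/orP; right.
  by rewrite (le_trans (bigmin_le_id _ _ _ _))// lerDl.
by apply: (le_trans (bigmin_le _ m _)); have := h m; lra.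
Qed.

Lemma bump_lip r n x y : 0 <= r -> `|bump r n x - bump r n y| <= `|x - y|.
Proof.
move=> r0; have := bump_lip1 n x y r0; have := bump_lip1 n y x r0.
by rewrite [`|y - x|]distrC ler_norml; lra.
Qed.

Lemma bump_eq0_near r m n x : `|x - a m| <= r -> (m < n)%N -> bump r n x = 0.
Proof.
move=> xm mn; apply/max_idPl; rewrite ge_min; apply/orP; right.
by apply: (le_trans (bigmin_le _ (Ordinal mn) _)) => /=; lra.
Qed.

Lemma bump_eq0_far r n x : 3 * r <= `|x - a n| -> bump r n x = 0.
Proof. by move=> xn; apply/max_idPl; rewrite ge_min subr_le0 xn. Qed.

(** The point [a 0], which is 0, is within [r] of [x] and of 0, so all later bumps vanish at both.
    The bump of index 0 has an empty inner minimum and equals its cap [r] at both. *)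
Lemma bump_center r n x : 0 <= r -> `|x| <= r -> bump r n x = bump r n 0.
Proof.
move=> r0 xr; case: n => [|n]; last first.
  by rewrite !(@bump_eq0_near r 0%N) ?a0 ?subr0 ?normr0.
rewrite /bump !big_ord0 a0 !subr0 normr0 subr0 !min_r//; lra.
Qed.

(** The least [n] with [a n] within [3 * r / 2] of [x] works: earlier points are farther away, so
    every term of the minimum is at least [r / 2]. *)
Lemma bump_large r x : 0 < r -> exists n, r / 2 <= bump r n x.
Proof.
move=> r0; have r2 : 0 < 3 * r / 2 by rewrite divr_gt0// mulr_gt0.
have ex : exists n, `|x - a n| <= 3 * r / 2 by exact: a_dense.
exists (ex_minn ex); case: ex_minnP => n xn nmin.
rewrite le_max le_min; apply/orP; right; apply/andP; split; first by lra.
apply: le_bigmin => [|m _]; first by lra.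
have : 3 * r / 2 < `|x - a m|.
  by rewrite ltNge; apply/negP => /nmin; rewrite leqNgt ltn_ord.
lra.
Qed.

Lemma bump_finite r x : 0 < r -> exists N, forall n, (N <= n)%N ->
  bump r n x = 0.
Proof.
move=> r0; have [m xm] := a_dense x r0.
by exists m.+1 => n mn; exact: bump_eq0_near xm mn.
Qed.

(** Sparse enough that finitely many indices give a scale in a compact interval of positive reals,
    dense enough that every positive real is within a factor 2 of a scale. *)
Definition scale (s : bool * nat) : R :=
  if s.1 then s.2.+1%:R else s.2.+1%:R^-1.

Lemma scale_gt0 s : 0 < scale s.
Proof. by rewrite /scale; case: ifP => _; rewrite ?invr_gt0 ltr0n. Qed.

Lemma scale_between (u : R) : 0 < u -> exists2 s, scale s <= u & u <= 2 * scale s.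
Proof.
move=> u0; have [u1|u1] := leP 1 u.
  have /andP[lo hi] := truncn_itv (ltW u0).
  have t0 : (0 < Num.trunc u)%N by rewrite truncn_gt0.
  exists (true, (Num.trunc u).-1); rewrite /scale/= prednK//.
  have : (1 : R) <= (Num.trunc u)%:R by rewrite ler1n.
  by move: hi; rewrite -natr1; lra.
have v0 : 0 < u^-1 by rewrite invr_gt0.
have v1 : 1 < u^-1 by rewrite invf_gt1.
have /andP[lo hi] := truncn_itv (ltW v0).
exists (false, Num.trunc u^-1); rewrite /scale/=.
  by rewrite -[leRHS]invrK lef_pV2 ?posrE ?ltr0n ?(ltW hi).
rewrite -[u]invrK ler_pdivlMr ?ltr0n// mulrC ler_pdivrMr//.
by move: lo; rewrite invrK -natr1; lra.
Qed.

Lemma scale_finite (e M : R) : 0 < e -> exists N, forall s,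
  e <= scale s -> scale s <= M -> (s.2 < N)%N.
Proof.
move=> e0; exists (maxn (Num.trunc M) (Num.trunc e^-1)) => -[b n].
rewrite /scale/=; case: b => es sM; rewrite leq_max.
  by rewrite truncn_ge_nat ?sM// (le_trans _ sM).
rewrite (@truncn_ge_nat _ e^-1) ?invr_ge0 ?(ltW e0)// orbC.
by rewrite -[leLHS]invrK lef_pV2 ?posrE ?invr_gt0 ?ltr0n ?es.
Qed.

(** Scales below [e] give differences below [e], and scales above the norm of [x] give 0 by
    [bump_center]. Each of the finitely many other scales has finitely many bumps that are nonzero
    at [x] or at 0. *)
Lemma aharoni_finite x (e : R) : 0 < e -> finite_set
  [set k : bool * nat * nat | e <= `|bump (scale k.1) k.2 x - bump (scale k.1) k.2 0|].
Proof.
move=> e0; have [N hN] := @scale_finite e `|x| e0.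
have ex s : exists n0, forall n, (n0 <= n)%N ->
    bump (scale s) n x = 0 /\ bump (scale s) n 0 = 0.
  have [n1 h1] := bump_finite x (scale_gt0 s).
  have [n2 h2] := bump_finite 0 (scale_gt0 s).
  by exists (maxn n1 n2) => n; rewrite geq_max => /andP[/h1 ? /h2].
have [B hB] := choice ex.
pose M := \max_(s : bool * 'I_N) B (s.1, s.2 : nat).
apply: (@sub_finite_set _ _ ([set: bool] `*` `I_N `*` `I_M)); last first.
  by apply: finite_setX; [apply: finite_setX|].
move=> [s n] /= en.
have sN : (s.2 < N)%N.
  apply: hN; last first.
    rewrite leNgt; apply/negP => /ltW xs; move: en.
    by rewrite (bump_center _ (ltW (scale_gt0 s)) xs) subrr normr0 leNgt e0.
  apply: (le_trans en); have s0 := ltW (scale_gt0 s).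
  rewrite ler_norml; have := bump_ge0 (scale s) n x.
  have := bump_ge0 (scale s) n 0; have := bump_le n x s0.
  by have := bump_le n 0 s0; lra.
split=> //=; rewrite ltnNge; apply/negP => Mn.
have [] := hB s n; last by move=> bx b0; move: en; rewrite bx b0 subrr normr0 leNgt e0.
apply: leq_trans Mn.
by rewrite (leq_trans _ (leq_bigmax (s.1, Ordinal sN)))//=; case: (s).
Qed.

(** Subtracting the values at 0 puts the image in c_0 without affecting differences. *)
Definition aharoni x : c0 R (bool * nat * nat)%type :=
  sval (c0_ex (@aharoni_finite x)).

Lemma aharoniE x k :
  aharoni x k = bump (scale k.1) k.2 x - bump (scale k.1) k.2 0.
Proof. exact: (svalP (c0_ex (@aharoni_finite x)) k). Qed.

Lemma aharoniB x y k : (aharoni x - aharoni y) k =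
  bump (scale k.1) k.2 x - bump (scale k.1) k.2 y.
Proof.
by rewrite -[LHS]/(aharoni x k - aharoni y k) !aharoniE opprB addrA subrK.
Qed.

Lemma aharoni_lip x y : `|aharoni x - aharoni y| <= `|x - y|.
Proof.
by apply: c0_norm_le => k; rewrite aharoniB bump_lip// ltW// scale_gt0.
Qed.

(** Let d be the distance from [x] to [y]. A scale s between d/12 and d/6 has a bump of at least
    s/2, hence d/24, at [x]; it lives in a ball of radius 3s, which cannot also contain [y] since d
    is at least 6s. *)
Lemma aharoni_expand x y : `|x - y| / 24 <= `|aharoni x - aharoni y|.
Proof.
have [->|xy] := eqVneq x y; first by rewrite !subrr !normr0 mul0r.
have d0 : 0 < `|x - y| / 6 by rewrite divr_gt0// normr_gt0 subr_eq0.
have [s slo shi] := scale_between d0.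
have s0 := scale_gt0 s.
have [n xn] := bump_large x s0.
have yn : bump (scale s) n y = 0.
  apply: bump_eq0_far; rewrite leNgt; apply/negP => yn.
  have xn' : `|x - a n| < 3 * scale s.
    rewrite ltNge; apply/negP => /bump_eq0_far bx; move: xn; rewrite bx; lra.
  by have := ler_distD (a n) x y; rewrite [`|a n - y|]distrC; lra.
apply: le_trans (c0_coord_le _ (s, n)).
rewrite aharoniB/= yn subr0 ger0_norm ?bump_ge0//; lra.
Qed.

End aharoni.

(** * Basis vectors and weak convergence in l_p *)

Section ell_theory.
Variables (R : realType) (p : R) (p1 : 1 <= p).
Local Notation lp := (ell p1).
Implicit Types (x y : lp) (s r : R).

Let p0 : 0 < p. Proof. exact: lt_le_trans p1. Qed.

Lemma ell_coordD x y k : ell_seq (x + y) k = x k + y k. Proof. by []. Qed.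

Lemma ell_coordN x k : ell_seq (- x) k = - x k. Proof. by []. Qed.

Lemma ell_coordZ s x k : ell_seq (s *: x) k = s * x k. Proof. by []. Qed.

(** For the lower bound on the limit, [ell_partial] is applied with the supremum of the partial
    sums: it yields a vector with the coordinates of [x], hence [x] itself, whose norm is controlled
    by that supremum. *)
Lemma ell_partial_cvg x :
  \sum_(0 <= k < n) `|x k| `^ p @[n --> \oo] --> `|x| `^ p.
Proof.
pose S n := \sum_(0 <= k < n) `|x k| `^ p.
have Snd : nondecreasing_seq S.
  by apply/nondecreasing_seqP => n; rewrite /S big_nat_recr//= lerDl powR_ge0.
have Sub : has_ubound (range S).
  by exists (`|x| `^ p) => _ [n _ <-]; exact: ell_norm_partial.
have Scv := nondecreasing_cvgn Snd Sub.
suff <- : sup (range S) = `|x| `^ p by [].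
have Sle n : S n <= sup (range S) by apply: ub_le_sup => //; exists n.
have sup0 : 0 <= sup (range S).
  by apply: le_trans (Sle 0%N); rewrite /S big_geq.
apply/eqP; rewrite eq_le; apply/andP; split.
  apply: ge_sup; first by exists (S 0%N), 0%N.
  by move=> _ [n _ <-]; exact: ell_norm_partial.
have supE : (sup (range S) `^ p^-1) `^ p = sup (range S).
  by rewrite -powRrM mulVf ?gt_eqF// powRr1.
have [|y yx yle] := @ell_partial R p p1 x (sup (range S) `^ p^-1) (powR_ge0 _ _).
  by move=> n; rewrite supE; exact: Sle.
have <- : y = x by apply/ell_eqP.
rewrite -supE; apply: ge0_ler_powR => //; first exact: ltW.
all: by rewrite nnegrE ?normr_ge0 ?powR_ge0.
Qed.

Lemma ell_basis_ex n : exists x : lp, x =1 (fun k => (k == n)%:R).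
Proof.
have [|x xE _] := @ell_partial R p p1 (fun k => (k == n)%:R) 1 ler01.
  move=> N; rewrite powR1.
  rewrite (eq_bigr (fun k => if k == n then 1 else 0)) => [|k _].
    by rewrite -big_mkcond big_nat1_eq; case: ifP.
  by case: eqP => _; rewrite ?normr1 ?powR1// normr0 powR0// gt_eqF.
by exists x.
Qed.

Definition ell_basis n : lp := sval (cid (ell_basis_ex n)).

Lemma ell_basisE n k : ell_basis n k = (k == n)%:R.
Proof. exact: (svalP (cid (ell_basis_ex n)) k). Qed.

Lemma ell_normD_basis x s n : x n = 0 ->
  `|x + s *: ell_basis n| `^ p = `|x| `^ p + `|s| `^ p.
Proof.
move=> xn; rewrite -(cvg_lim _ (@ell_partial_cvg (_ + _)))//; apply: cvg_lim => //.
have h : \sum_(0 <= k < N) `|x k| `^ p + `|s| `^ p @[N --> \oo] -->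
    `|x| `^ p + `|s| `^ p.
  by apply: cvgD; [exact: ell_partial_cvg|exact: cvg_cst].
apply: cvg_trans h; apply: near_eq_cvg; near=> N.
have nN : (n < N)%N by near: N; exact: nbhs_infty_gt.
have -> : `|s| `^ p = \sum_(0 <= k < N) (if k == n then `|s| `^ p else 0).
  by rewrite -big_mkcond big_nat1_eq ifT.
rewrite -big_split; apply: eq_bigr => k _.
rewrite ell_coordD ell_coordZ ell_basisE/=.
case: eqP => [->|_]; last by rewrite mulr0 !addr0.
by rewrite xn normr0 powR0 ?gt_eqF// mulr1 !add0r.
Unshelve. all: by end_near. Qed.

Lemma ell_norm_basisZ s n : `|s *: ell_basis n| = `|s|.
Proof.
have := @ell_normD_basis 0 s n erefl.
rewrite add0r normr0 powR0 ?gt_eqF// add0r => /(congr1 (fun t => t `^ p^-1)).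
by rewrite -!powRrM mulfV ?gt_eqF// !powRr1.
Qed.

(** Leaves every late index free for the next basis vector of a chain. *)
Definition finsupp x := \forall n \near \oo, x n = 0.

(* Greedy choice of x_k = s_1 e_{n_1} + ... + s_k e_{n_k} with distinct n_i. *)
Lemma ell_chain (r : R) (Q : nat -> lp -> Prop) : Q 0%N 0 ->
  (forall k x, finsupp x -> Q k x -> exists n s,
    [/\ `|s| = r, x n = 0 & Q k.+1 (x + s *: ell_basis n)]) ->
  forall k, exists x, [/\ finsupp x, `|x| `^ p = k%:R * r `^ p & Q k x].
Proof.
move=> Q0 QS; elim=> [|k [x [xf xk /(QS _ _ xf)[n [s [sr xn Qx]]]]]].
  exists 0; split => //; first exact: nearW.
  by rewrite normr0 powR0 ?gt_eqF// mul0r.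
exists (x + s *: ell_basis n); split => //; last first.
  by rewrite ell_normD_basis// sr xk mulrSr mulrDl mul1r.
near=> m; rewrite ell_coordD ell_coordZ ell_basisE.
rewrite (_ : x m = 0); last by near: m.
rewrite gtn_eqF ?mulr0 ?addr0//.
by near: m; exact: nbhs_infty_gt.
Unshelve. all: by end_near. Qed.

End ell_theory.

(** As [1 - t] is positive, the power of [k] with this exponent eventually exceeds |C| / c. *)
Lemma powR_sublinear (R : realType) (c C t : R) : 0 < c -> t < 1 ->
  (forall k, k%:R * c <= C * k%:R `^ t) -> False.
Proof.
move=> c0 t1 h; have t0 : 0 < 1 - t by rewrite subr_gt0.
have [k kC] : exists k : nat, (`|C| / c + 1) `^ (1 - t)^-1 <= k.+1%:R.
  exists (Num.trunc ((`|C| / c + 1) `^ (1 - t)^-1)).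
  by rewrite ltW// truncnS_gt.
have C1 : 0 < `|C| / c + 1 by rewrite ltr_wpDl// divr_ge0// ltW.
have k0 : 0 < k.+1%:R :> R by rewrite ltr0n.
have kt0 : 0 < k.+1%:R `^ t :> R by rewrite powR_gt0.
have : `|C| / c + 1 <= k.+1%:R `^ (1 - t).
  have <- : ((`|C| / c + 1) `^ (1 - t)^-1) `^ (1 - t) = `|C| / c + 1.
    by rewrite -powRrM mulVf ?gt_eqF// powRr1// ltW.
  by apply: ge0_ler_powR; rewrite ?nnegrE ?powR_ge0// ltW.
apply/negP; rewrite -ltNge -ltrBlDr.
have kE : k.+1%:R `^ (1 - t) = k.+1%:R / k.+1%:R `^ t :> R.
  by rewrite powRD ?gt_eqF ?implybT// powRN powRr1// ltW.
apply: (@lt_le_trans _ _ (k.+1%:R `^ (1 - t))); first by rewrite ltrBlDr ltrDl.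
rewrite kE ler_pdivlMr// mulrAC ler_pdivrMr//.
by apply: le_trans (h k.+1) _; rewrite ler_wpM2r ?ler_norm// ltW.
Qed.

Section weak_convergence.
Variables (R : realType) (X : normedModType R).
Implicit Types (u : nat -> X) (x : X).

(** Packs a plain function, such as a coordinate, into the bundled linear map that [weakly_cvg]
    expects; the norm bound gives continuity. *)
Lemma weakly_cvg_functional (phi : X -> R^o) u x : linear phi ->
  (forall y, `|phi y| <= `|y|) -> weakly_cvg u x ->
  phi (u n) @[n --> \oo] --> phi x.
Proof.
move=> lin le1 ux.
pose L : {linear X -> R^o} := HB.pack phi (GRing.isLinear.Build R X R^o *:%R phi lin).
apply: (ux L); apply/linear_bounded_continuous/linear_boundedP.
near=> r => y /=; apply: (le_trans (le1 y)); rewrite ler_peMl//.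
Unshelve. all: by end_near. Qed.

Lemma weakly_cvgDZ u x (s : R) : weakly_cvg u 0 ->
  weakly_cvg (fun n => x + s *: u n) x.
Proof.
move=> u0 phi cphi.
have h : phi x + s *: phi (u n) @[n --> \oo] --> phi x + s *: phi 0.
  apply: cvgD; first exact: cvg_cst.
  by apply: cvgZ; [exact: cvg_cst|exact: u0].
rewrite linear0 scaler0 addr0 in h.
apply: cvg_trans h; apply: near_eq_cvg; apply: nearW => n.
by rewrite linearD linearZ.
Qed.

End weak_convergence.

Section ell_weak.
Variables (R : realType) (p : R) (p1 : 1 <= p).
Local Notation lp := (ell p1).

Let p0 : 0 < p. Proof. exact: lt_le_trans p1. Qed.

Lemma ell_weakly_cvg_coord (u : nat -> lp) (x : lp) k : weakly_cvg u x ->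
  u n k @[n --> \oo] --> x k.
Proof.
move=> ux; apply: (@weakly_cvg_functional R lp (fun y : lp => y k) u x) => //.
by move=> y; exact: ell_coord_le.
Qed.

(* A functional of size at least e on infinitely many basis vectors would be at
   least k e on a vector of norm k^(1/p). *)
Lemma ell_basis_weakly_null : 1 < p -> weakly_cvg (ell_basis p1) 0.
Proof.
move=> ltp phi cphi; rewrite linear0.
have [C [_ hC]] : exists C, C \is Num.real /\ forall x, `|phi x| <= C * `|x|.
  have /linear_bounded_continuous/linear_boundedP h := cphi.
  have [C hC] := filter_ex h.
  by exists C; split => //; rewrite num_real.
apply/cvgrPdist_le => e e0; apply: contrapT => notnear.
have chain : forall k, exists x : lp,
    [/\ finsupp x, `|x| `^ p = k%:R * 1 `^ p & k%:R * e <= phi x].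
  apply: ell_chain; first by rewrite linear0 mul0r.
  move=> k x xf xk.
  have [n [xn ne]] : exists n, x n = 0 /\ e < `|phi (ell_basis p1 n)|.
    apply: contrapT => no; apply: notnear; apply: filterS xf => n xn.
    rewrite sub0r normrN leNgt; apply/negP => en.
    by apply: no; exists n.
  have ph0 : phi (ell_basis p1 n) != 0 by rewrite -normr_gt0 (lt_trans e0).
  (* With this sign the new term adds the absolute value of [phi (ell_basis p1 n)], which exceeds
     [e]. *)
  exists n, (Num.sg (phi (ell_basis p1 n))); split => //.
    by rewrite normr_sg ph0.
  rewrite linearD linearZ -natr1 mulrDl mul1r lerD//.
  by rewrite normrEsg in ne; exact: ltW.
apply: (@powR_sublinear R e C p^-1 e0); first by rewrite invf_lt1.
move=> k; have [x [_ xk kx]] := chain k.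
have -> : k%:R `^ p^-1 = `|x|.
  by move: xk; rewrite powR1 mulr1 => <-; rewrite -powRrM mulfV ?gt_eqF// powRr1.
by apply: (le_trans kx); apply: le_trans (hC x); rewrite ler_norm.
Qed.

(* The first N coordinates of u n converge to those of y, and for the others
   one uses (|v - y| / 2)^p <= |v|^p + |y|^p, where the tail of y is small. *)
Lemma ell_norm_jump (u : nat -> lp) (y : lp) (d : R) : 0 < d ->
  (forall k, u n k @[n --> \oo] --> y k) -> (forall n, d <= `|u n - y|) ->
  \forall n \near \oo, `|y| `^ p + (d / 2) `^ p / 2 <= `|u n| `^ p.
Proof.
move=> d0 uy ud.
have c0 : 0 < 2^-1 `^ p :> R by rewrite powR_gt0.
set c := 2^-1 `^ p in c0.
have -> : (d / 2) `^ p = c * d `^ p by rewrite mulrC powRM// ltW.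
have dp0 : 0 < d `^ p by rewrite powR_gt0.
(* The gain is 6 [eta]: two are lost by using [S N y] twice for the full sum, one by the convergence
   in [n], and three remain, half of the gain. *)
pose eta := c * d `^ p / 6.
have eta0 : 0 < eta by rewrite divr_gt0// mulr_gt0.
pose S N (x : lp) := \sum_(0 <= k < N) `|x k| `^ p.
have [N SN] : exists N, `|y| `^ p - eta <= S N y.
  have /cvgrPdist_le/(_ _ eta0)/filter_ex[N hN] := @ell_partial_cvg R p p1 y.
  exists N; move: hN; rewrite ler_norml /S; lra.
(* The series [H] has nonnegative terms by the halving inequality, so its partial sum at [N] is at
   most its limit. *)
have ineq (v : lp) : S N v - c * S N (v - y) + S N y <=
    `|v| `^ p - c * `|v - y| `^ p + `|y| `^ p.
  pose H M := \sum_(0 <= k < M) (`|v k| `^ p - c * `|v k - y k| `^ p + `|y k| `^ p).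
  have HE M : H M = S M v - c * S M (v - y) + S M y.
    by rewrite /H big_split sumrB -mulr_sumr.
  have Hnd : nondecreasing_seq H.
    apply/nondecreasing_seqP => M; rewrite /H big_nat_recr//= lerDl.
    have tri := ler_normB (v M) (y M).
    have v0 := powR_ge0 `|v M| p; have y0 := powR_ge0 `|y M| p.
    have half (z : R) : `|v M - y M| <= 2 * `|z| ->
        c * `|v M - y M| `^ p <= `|z| `^ p.
      move=> hz; rewrite mulrC -powRM//; apply: ge0_ler_powR.
      - exact: ltW.
      - by rewrite nnegrE divr_ge0.
      - by rewrite nnegrE.
      - by rewrite ler_pdivrMr// mulrC.
    have [vy|/ltW yv] := leP `|v M| `|y M|.
      have : c * `|v M - y M| `^ p <= `|y M| `^ p by apply: half; lra.
      lra.
    have : c * `|v M - y M| `^ p <= `|v M| `^ p by apply: half; lra.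
    lra.
  have Hcv : H M @[M --> \oo] --> `|v| `^ p - c * `|v - y| `^ p + `|y| `^ p.
    under eq_fun do rewrite HE.
    apply: cvgD; last exact: ell_partial_cvg.
    apply: cvgB; first exact: ell_partial_cvg.
    by apply: cvgM; [exact: cvg_cst|exact: ell_partial_cvg].
  rewrite -HE -(cvg_lim _ Hcv)//; apply: nondecreasing_cvgn_le => //.
  by apply/cvg_ex; eexists; exact: Hcv.
have cv : S N (u n) - c * S N (u n - y) + S N y @[n --> \oo] -->
    S N y - c * S N (y - y) + S N y.
  apply: cvgD; last exact: cvg_cst.
  apply: cvgB.
    apply: cvg_big => //; first exact: add_continuous.
    move=> k _; apply: (@continuous_cvg _ _ _ _ _ _ (fun r : R => `|r| `^ p)).
      exact: continuous_norm_powR.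
    exact: uy.
  apply: cvgM; first exact: cvg_cst.
  apply: cvg_big => //; first exact: add_continuous.
  move=> k _; apply: (@continuous_cvg _ _ _ _ _ _ (fun r : R => `|r| `^ p)).
    exact: continuous_norm_powR.
  by apply: cvgB; [exact: uy|exact: cvg_cst].
have S0 : S N (y - y) = 0.
  rewrite /S big1// => k _.
  by rewrite ell_coordD ell_coordN subrr normr0 powR0 ?gt_eqF.
rewrite S0 mulr0 subr0 in cv.
have /cvgrPdist_le/(_ _ eta0) := cv.
apply: filterS => n; rewrite ler_norml => /andP[_ hn].
have := ineq (u n); have : c * d `^ p <= c * `|u n - y| `^ p.
  rewrite ler_pM2l//; apply: ge0_ler_powR; rewrite ?nnegrE ?(ltW p0) ?(ltW d0)//.
have -> : c * d `^ p / 2 = 3 * eta by rewrite /eta; field.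
have -> : c * d `^ p = 6 * eta by rewrite /eta; field.
move: hn SN; lra.
Qed.

End ell_weak.

(** * Maps into l_p *)

Section moduli.
Variables (R : realType) (X Y : normedModType R).
Implicit Types f : X -> Y.

Lemma omega_le f (t : R) (w : R) : 0 <= t -> (omega f t <= w%:E)%E <->
  forall x y, `|x - y| <= t -> `|f x - f y| <= w.
Proof.
move=> t0; split=> [h x y xy|h].
  rewrite -lee_fin; apply: le_trans h; apply: ereal_sup_ubound.
  by exists (x, y).
by apply: ge_ereal_sup => _ [[x y] /= xy <-]; rewrite lee_fin h.
Qed.

Lemma omega_ge0 f (t : R) : 0 <= t -> (0 <= omega f t)%E.
Proof.
move=> t0; apply: ereal_sup_ubound; exists (0, 0) => /=.
  by rewrite subrr normr0.
by rewrite subrr normr0.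
Qed.

Lemma omega_fin f (t : R) : 0 <= t -> (omega f t < +oo)%E ->
  exists2 w, 0 <= w & forall x y, `|x - y| <= t -> `|f x - f y| <= w.
Proof.
move=> t0 h; have w0 := omega_ge0 f t0.
exists (fine (omega f t)); first exact: fine_ge0.
by apply/omega_le => //; rewrite fineK// ge0_fin_numE.
Qed.

(** The segment from [y] to [x] is cut into pieces of length at most 1, each moving [f] by at most
    [K]; their number is the integer part of the length plus 1. *)
Lemma coarse_large_lipschitz f : coarse f -> exists2 K, 0 <= K &
  forall x y, `|f x - f y| <= K * (`|x - y| + 1).
Proof.
move=> /(_ 1 ler01)/(omega_fin ler01)[K K0 hK]; exists K => //.
have step n : forall x y, `|x - y| <= n%:R -> `|f x - f y| <= K * n%:R.
  elim: n => [x y|n IH x y xy].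
    by rewrite normr_le0 subr_eq0 => /eqP ->; rewrite subrr normr0 mulr0.
  pose l : R := n%:R / n.+1%:R.
  pose z := y + l *: (x - y).
  have n0 : 0 < n.+1%:R :> R by rewrite ltr0n.
  have l1 : 1 - l = n.+1%:R^-1.
    by rewrite /l; move: n0; rewrite -natr1 => n0; field; rewrite gt_eqF.
  have zy : `|z - y| <= n%:R.
    rewrite /z addrAC subrr add0r normrZ ger0_norm ?divr_ge0//.
    by rewrite -mulrA ler_piMr// mulrC ler_pdivrMr// mul1r.
  have xz : `|x - z| <= 1.
    have -> : x - z = (1 - l) *: (x - y).
      by rewrite scalerBl scale1r /z opprD addrA.
    by rewrite l1 normrZ ger0_norm ?invr_ge0 ?(ltW n0)// mulrC ler_pdivrMr// mul1r.
  rewrite -natr1 mulrDr mulr1 [leRHS]addrC.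
  apply: (le_trans (ler_distD (f z) _ _)).
  by apply: lerD; [exact: hK|exact: IH].
move=> x y; have /andP[lo hi] := truncn_itv (normr_ge0 (x - y)).
apply: (le_trans (step _ _ _ (ltW hi))).
by rewrite ler_wpM2l// -natr1 lerD2r.
Qed.

Lemma ereal_inf_gt0 (S : set (\bar R)) : (0 < ereal_inf S)%E ->
  exists2 d : R, 0 < d & forall z, S z -> (d%:E <= z)%E.
Proof.
move=> S0; have lb z : S z -> (ereal_inf S <= z)%E by exact: ereal_inf_lbound.
case E : (ereal_inf S) S0 lb => [d| |]// d0 lb; first by exists d.
by exists 1 => // z /lb; apply: le_trans; rewrite leey.
Qed.

(** The chain built later moves by steps of norm exactly [a], so the gap is extracted at this single
    distance. *)
Lemma property_star_gap f : property_star f -> exists a d : R,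
  [/\ 0 < a, 0 < d & forall x y, `|x - y| = a -> d <= `|f x - f y|].
Proof.
move=> [a [b [a0 ab /ereal_inf_gt0[d d0 hd]]]]; exists a, d; split => // x y xy.
by rewrite -lee_fin; apply: hd; exists (x, y) => //=; rewrite xy lexx ltW.
Qed.

Lemma rho_ge f (t w : R) : (forall x y, t <= `|x - y| -> w <= `|f x - f y|) ->
  (w%:E <= rho f t)%E.
Proof.
by move=> h; apply: le_ereal_inf_tmp => _ [[x y] /= xy <-]; rewrite lee_fin h.
Qed.

Lemma rho_le f (t : R) x y : t <= `|x - y| -> (rho f t <= `|f x - f y|%:E)%E.
Proof. by move=> xy; apply: ereal_inf_lbound; exists (x, y). Qed.

End moduli.

Lemma ell_no_weakly_seq_continuous (R : realType) (p q : R) (p1 : 1 <= p)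
  (q1 : 1 <= q) (f : ell q1 -> ell p1) : p < q ->
  weakly_seq_continuous f -> coarse f -> ~ property_star f.
Proof.
move=> pq wf cf /property_star_gap[a [d [a0 d0 fa]]].
have p0 : 0 < p by exact: (lt_le_trans ltr01 p1).
have q0 : 0 < q by exact: (lt_trans p0 pq).
have q1' : 1 < q by exact: (le_lt_trans p1 pq).
have [K K0 fK] := coarse_large_lipschitz cf.
pose c := (d / 2) `^ p / 2.
have c0 : 0 < c by rewrite divr_gt0// powR_gt0// divr_gt0.
have chain : forall k, exists x : ell q1, [/\ finsupp x,
    `|x| `^ q = k%:R * a `^ q & k%:R * c <= `|f x - f 0| `^ p].
  apply: ell_chain; first by rewrite mul0r powR_ge0.
  move=> k x xf xk.
  have wx := @weakly_cvgDZ R _ _ x a (ell_basis_weakly_null q1').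
  (* The images converge coordinatewise to [f x] and stay at distance at least [d] from it; after
     translation by [f 0], this is the setting of [ell_norm_jump]. *)
  have jump : \forall n \near \oo,
      `|f x - f 0| `^ p + c <= `|f (x + a *: ell_basis q1 n) - f 0| `^ p.
    apply: (@ell_norm_jump R p p1
      (fun n => f (x + a *: ell_basis q1 n) - f 0) (f x - f 0) d d0).
      move=> j.
      have h : f (x + a *: ell_basis q1 n) j - f 0 j @[n --> \oo] --> f x j - f 0 j.
        apply: cvgB; last exact: cvg_cst.
        exact: (@ell_weakly_cvg_coord R p p1 _ _ j (wf _ _ wx)).
      exact: h.
    move=> n; rewrite opprB addrA subrK; apply: fa.
    by rewrite addrAC subrr add0r ell_norm_basisZ gtr0_norm.
  have [n [xn hn]] := filter_ex (filterI xf jump).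
  exists n, a; split; [exact: gtr0_norm|exact: xn|].
  apply: le_trans hn; rewrite -natr1 mulrDl mul1r.
  by rewrite lerD2r.
have pq1 : p / q < 1 by rewrite ltr_pdivrMr// mul1r.
(* The constant comes from a k^(1/q) + 1 <= (a + 1) k^(1/q), valid for k >= 1; hence the separate
   case of [k = 0]. *)
apply: (@powR_sublinear R c ((K * (a + 1)) `^ p) (p / q) c0 pq1) => k.
have [->|k0] := eqVneq k 0%N; first by rewrite mul0r mulr_ge0// powR_ge0.
have [x [_ xk kx]] := chain k.
have k1 : 1 <= k%:R `^ q^-1 :> R.
  apply: (@le_trans _ _ (1 `^ q^-1)); first by rewrite powR1.
  apply: ge0_ler_powR; rewrite ?nnegrE ?invr_ge0 ?(ltW q0)//.
  by rewrite ler1n lt0n.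
have xE : `|x| = k%:R `^ q^-1 * a.
  have <- : (`|x| `^ q) `^ q^-1 = `|x| by rewrite -powRrM mulfV ?gt_eqF// powRr1.
  by rewrite xk powRM ?powR_ge0// -powRrM mulfV ?gt_eqF// powRr1// ltW.
apply: (le_trans kx).
rewrite [p / q]mulrC powRrM -powRM ?powR_ge0 ?mulr_ge0 ?addr_ge0 ?(ltW a0)//.
apply: ge0_ler_powR; rewrite ?nnegrE ?mulr_ge0 ?powR_ge0 ?addr_ge0 ?(ltW a0) ?(ltW p0)//.
apply: (le_trans (fK x 0)); rewrite subr0 xE -mulrA ler_wpM2l//; lra.
Qed.

(** * Separability of l_p *)

Section ell_separable.
Variables (R : realType) (p : R) (p1 : 1 <= p).
Local Notation lp := (ell p1).

Let p0 : 0 < p. Proof. exact: lt_le_trans p1. Qed.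

Definition ell_tail (x : lp) N : lp :=
  x - \sum_(0 <= k < N) x k *: ell_basis p1 k.

Lemma ell_tailS x N :
  ell_tail x N.+1 = ell_tail x N - x N *: ell_basis p1 N.
Proof. by rewrite /ell_tail big_nat_recr//= opprD addrA. Qed.

Lemma ell_tail_coord x N k :
  ell_seq (ell_tail x N) k = if (k < N)%N then 0 else x k.
Proof.
elim: N => [|N IH]; first by rewrite /ell_tail big_geq// subr0.
rewrite ell_tailS ell_coordD ell_coordN ell_coordZ ell_basisE IH ltnS.
have [kN|kN|->] := ltngtP k N; rewrite ?mulr0 ?subr0//.
by rewrite mulr1 subrr.
Qed.

(** Coordinates are split off one at a time, and [ell_normD_basis] makes the p-th powers add. *)
Lemma ell_tail_norm x N :
  `|ell_tail x N| `^ p + \sum_(0 <= k < N) `|x k| `^ p = `|x| `^ p.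
Proof.
elim: N => [|N IH]; first by rewrite /ell_tail !big_geq// subr0 addr0.
rewrite big_nat_recr//= addrCA addrC -IH; congr (_ + _).
have E : ell_tail x N = ell_tail x N.+1 + x N *: ell_basis p1 N.
  by rewrite ell_tailS subrK.
by rewrite E ell_normD_basis// ell_tail_coord ltnSn.
Qed.

Lemma ell_tail_small x (e : R) : 0 < e -> exists N, `|ell_tail x N| <= e.
Proof.
move=> e0; have ep0 : 0 < e `^ p by rewrite powR_gt0.
have /cvgrPdist_lt/(_ _ ep0)/filter_ex[N hN] := @ell_partial_cvg R p p1 x.
exists N; rewrite leNgt; apply/negP => tN.
have : e `^ p < `|ell_tail x N| `^ p.
  by apply: gt0_ltr_powR; rewrite ?nnegrE// ltW.
move: hN; rewrite -(ell_tail_norm x N) addrK ger0_norm ?powR_ge0//.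
by move=> h1 h2; have := lt_trans h1 h2; rewrite ltxx.
Qed.

Definition ell_of_rat (s : seq rat) : lp :=
  \sum_(0 <= k < size s) ratr (nth 0 s k) *: ell_basis p1 k.

Lemma ell_of_rat_dense (x : lp) (e : R) : 0 < e ->
  exists s, `|x - ell_of_rat s| <= e.
Proof.
move=> e0; have e2 : 0 < e / 2 by rewrite divr_gt0.
have [N tN] := ell_tail_small x e2.
have N0 : 0 < N.+1%:R :> R by rewrite ltr0n.
(* Dividing by [N.+1] rather than [N] covers [N = 0]. *)
have d0 : 0 < e / 2 / N.+1%:R by rewrite divr_gt0.
have /choice[r hr] : forall k, exists r : rat, `|x k - ratr r| <= e / 2 / N.+1%:R.
  move=> k.
  have [|r] := @rat_in_itvoo R (x k) (x k + e / 2 / N.+1%:R); first by rewrite ltrDl.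
  rewrite in_itv/= => /andP[lo hi]; exists r.
  by rewrite distrC ger0_norm ?subr_ge0 ?(ltW lo)// lerBlDl ltW.
exists (mkseq r N).
have -> : x - ell_of_rat (mkseq r N) =
    ell_tail x N + \sum_(0 <= k < N) (x k - ratr (r k)) *: ell_basis p1 k.
  rewrite /ell_tail /ell_of_rat size_mkseq.
  rewrite -addrA; congr (_ + _).
  rewrite -sumrN -sumrN -big_split; apply: eq_big_nat => k /andP[_ kN].
  by rewrite nth_mkseq//= scalerBl addrA addNr add0r.
rewrite (splitr e); apply: (le_trans (ler_normD _ _)); apply: lerD => //.
apply: (le_trans (ler_norm_sum _ _ _)).
apply: (@le_trans _ _ (\sum_(0 <= k < N) e / 2 / N.+1%:R)).
  by apply: ler_sum => k _; rewrite ell_norm_basisZ.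
rewrite sumr_const_nat subn0 -[_ *+ N]mulr_natr mulrAC ler_pdivrMr//.
by rewrite ler_pM2l// ler_nat.
Qed.

(** Index 0 is reserved for the zero vector, where the dense sequence of the embedding into c_0 has
    to start. *)
Definition ell_dense_seq (n : nat) : lp :=
  if n is m.+1 then
    if unpickle m is Some s then ell_of_rat s else 0
  else 0.

Lemma ell_dense_seqP (x : lp) (e : R) : 0 < e ->
  exists n, `|x - ell_dense_seq n| <= e.
Proof.
move=> /(ell_of_rat_dense x)[s xs]; exists (pickle s).+1.
by rewrite /ell_dense_seq pickleK.
Qed.

End ell_separable.

(** * Maps into c_0 *)

Lemma finite_near (T : choiceType) (A : set T) (P : T -> nat -> Prop) :
  finite_set A -> (forall t, A t -> \forall n \near \oo, P t n) ->
  \forall n \near \oo, forall t, A t -> P t n.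
Proof.
move=> /finite_seqP[s ->]; elim: s => [|t s IH] h.
  by apply: nearW => n t.
have ht : \forall n \near \oo, P t n by apply: h => /=; rewrite mem_head.
have hs : \forall n \near \oo, forall t, t \in s -> P t n.
  by apply: IH => t' /= t's; apply: h => /=; rewrite in_cons t's orbT.
apply: filterS (filterI ht hs) => n [Pt Ps] t' /=.
by rewrite in_cons => /predU1P[->|/Ps].
Qed.

Section c0_obstruction.
Variables (R : realType) (T : pointedType) (q : R) (q1 : 1 <= q).
Variable f : ell q1 -> c0 R T.
Hypotheses (q_gt1 : 1 < q) (fw : weakly_seq_continuous f).

Lemma c0_weakly_cvg_coord (u : nat -> c0 R T) (v : c0 R T) k :
  weakly_cvg u v -> u n k @[n --> \oo] --> v k.
Proof.
move=> uv; apply: (@weakly_cvg_functional R _ (fun v : c0 R T => v k) u v) => //.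
by move=> y; exact: c0_coord_le.
Qed.

Lemma weak_step_near (x : ell q1) (s eta : R) (A : set T) : 0 < eta ->
  finite_set A -> \forall n \near \oo, forall t, A t ->
    `|f (x + s *: ell_basis q1 n) t - f x t| <= eta.
Proof.
move=> eta0 finA; apply: finite_near finA _ => t _.
have wx := @weakly_cvgDZ R _ _ x s (ell_basis_weakly_null q_gt1).
have /cvgrPdist_le/(_ _ eta0) := @c0_weakly_cvg_coord _ _ t (fw wx).
by apply: filterS => n; rewrite distrC.
Qed.

(* Along the chain, f x and f (- x) change essentially only where both were
   small, so that their distance does not accumulate in the sup norm. *)
Lemma c0_antipodal (r w : R) : 0 < r -> 0 <= w ->
  (forall x y, `|x - y| <= r -> `|f x - f y| <= w) ->
  forall M eta : R, 0 < eta ->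
  exists2 x, M <= `|x| & `|f x - f (- x)| <= 2 * w + eta.
Proof.
move=> r0 w0 fr M eta eta0; have q0 : 0 < q by exact: (lt_trans ltr01 q_gt1).
have rq0 : 0 < r `^ q by rewrite powR_gt0.
(* Enough steps for a final norm of at least [M], which may be negative. *)
pose k := (Num.trunc (Num.max M 0 `^ q / r `^ q)).+1.
have kM : Num.max M 0 `^ q <= k%:R * r `^ q.
  by rewrite -ler_pdivrMr// ltW// truncnS_gt.
have k0 : 0 < k%:R :> R by rewrite ltr0n.
(* Each step costs [2 * h], so the [k] steps cost [eta]. *)
pose h := eta / (2 * k%:R).
have h0 : 0 < h by rewrite divr_gt0// mulr_gt0.
have chain : forall j, exists x : ell q1, [/\ finsupp x,
    `|x| `^ q = j%:R * r `^ q & `|f x - f (- x)| <= 2 * w + 2 * (j%:R * h)].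
  apply: ell_chain.
    by rewrite oppr0 subrr normr0 mul0r mulr0 addr0 mulr_ge0.
  move=> j x xf xj.
  pose A := [set t | h <= `|f x t|] `|` [set t | h <= `|f (- x) t|].
  have finA : finite_set A by rewrite finite_setU; split; exact: c0_finite.
  (* The same index serves [x] and [- x], so that the two new points are again antipodal. *)
  have [n [xn [s1 s2]]] := filter_ex (filterI xf (filterI
    (weak_step_near x r h0 finA) (weak_step_near (- x) (- r) h0 finA))).
  exists n, r; split; [exact: gtr0_norm|exact: xn|].
  have x'E : - x + - r *: ell_basis q1 n = - (x + r *: ell_basis q1 n).
    by rewrite opprD scaleNr.
  rewrite x'E in s2.
  have d1 : `|f (x + r *: ell_basis q1 n) - f x| <= w.
    by apply: fr; rewrite addrAC subrr add0r ell_norm_basisZ gtr0_norm.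
  have d2 : `|f (- (x + r *: ell_basis q1 n)) - f (- x)| <= w.
    apply: fr; rewrite -x'E addrAC subrr add0r ell_norm_basisZ.
    by rewrite normrN gtr0_norm.
  move: (x + r *: ell_basis q1 n) s1 s2 d1 d2 {x'E} => x' s1 s2 d1 d2.
  apply: c0_norm_le => t.
  have e1 : `|f x' t - f x t| <= w.
    exact: le_trans (c0_coord_le (f x' - f x) t) d1.
  have e2 : `|f (- x') t - f (- x) t| <= w.
    exact: le_trans (c0_coord_le (f (- x') - f (- x)) t) d2.
  have e3 : `|f x t - f (- x) t| <= 2 * w + 2 * (j%:R * h).
    exact: le_trans (c0_coord_le (f x - f (- x)) t) xj.
  suff : `|f x' t - f (- x') t| <= 2 * w + 2 * (j.+1%:R * h) by [].
  have jh : 0 <= j%:R * h by rewrite mulr_ge0// ltW.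
  rewrite -natr1.
  (* On [A] both values move by at most [h], adding [2 * h] to the previous bound. Off [A] both were
     below [h] and move by at most [w], which gives [2 * w + 2 * h] whatever the previous bound. *)
  have [At|nAt] := pselect (A t).
    by move: (s1 t At) (s2 t At) e3; rewrite !ler_norml; lra.
  have b1 : `|f x t| < h by rewrite ltNge; apply/negP => ?; apply: nAt; left.
  have b2 : `|f (- x) t| < h.
    by rewrite ltNge; apply/negP => ?; apply: nAt; right.
  by move: b1 b2 e1 e2; rewrite !ltr_norml !ler_norml; lra.
have [x [_ xk xf]] := chain k; exists x.
  rewrite leNgt; apply/negP => xM.
  have : `|x| `^ q < Num.max M 0 `^ q.
    apply: gt0_ltr_powR; rewrite ?nnegrE//.
      by rewrite le_max lexx orbT.
    by rewrite lt_max xM.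
  by rewrite xk ltNge kM.
apply: (le_trans xf); rewrite lerD2l /h.
suff -> : 2 * (k%:R * (eta / (2 * k%:R))) = eta by [].
by field; rewrite gt_eqF.
Qed.

Lemma norm_antipodal (X : normedModType R) (x : X) : `|x - - x| = 2 * `|x|.
Proof. by rewrite opprK -mulr2n normrMn mulr_natl. Qed.

Lemma c0_no_coarse_embedding : ~ coarse_embedding f.
Proof.
move=> [cf rf]; have [w w0 fr] := omega_fin ler01 (cf 1 ler01).
have /cvgeyPgt/(_ (2 * w + 1))/filter_ex[t ht] := rf.
have [x xt xf] := c0_antipodal ltr01 w0 fr t ltr01.
have : (rho f t <= (2 * w + 1)%:E)%E.
  apply: (@le_trans _ _ (`|f x - f (- x)|%:E)); last by rewrite lee_fin.
  by apply: rho_le; rewrite norm_antipodal (le_trans xt)// ler_peMl// ler1n.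
by rewrite leNgt ht.
Qed.

Lemma c0_no_uniform_embedding : ~ uniform_embedding f.
Proof.
move=> [cf /(_ 2 (ltr0Sn _ _))/ereal_inf_gt0[d d0 hd]].
(* With [w] and the error both equal to [d / 8], antipodal images are within 3d/8, below the gap [d]
   valid at distances of at least 2. *)
have d8 : 0 < d / 8 by rewrite divr_gt0.
have small : 2 * (d / 8) + d / 8 < d.
  by rewrite [ltRHS](_ : _ = 8 * (d / 8)); [lra|field].
have : \forall t \near 0^'+, (omega f t < (d / 8)%:E)%E.
  by apply: (cf [set y | (y < (d / 8)%:E)%E]); apply: open_ereal_lt'; rewrite lte_fin.
move=> near_lt; have [t [t0 ht]] := filter_ex (filterI (nbhs_right_gt 0) near_lt).
have fr := (omega_le f (d / 8) (ltW t0)).1 (ltW ht).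
have [x x1 xf] := c0_antipodal t0 (ltW d8) fr 1 d8.
have : (d%:E <= `|f x - f (- x)|%:E)%E.
  by apply: hd; exists (x, - x) => //=; rewrite norm_antipodal ler_peMr.
by rewrite lee_fin => /le_trans/(_ xf); rewrite leNgt small.
Qed.

End c0_obstruction.

(** * Bi-Lipschitz embeddings and the pair (l_2, c_0) *)

Lemma lipschitz_coarse_embedding (R : realType) (X Y : normedModType R)
    (f : X -> Y) (c : R) : 0 < c -> (forall x y, `|f x - f y| <= `|x - y|) ->
  (forall x y, c * `|x - y| <= `|f x - f y|) ->
  coarse_embedding f /\ uniform_embedding f.
Proof.
move=> c0 fu fl.
have om t : 0 <= t -> (omega f t <= t%:E)%E.
  by move=> t0; apply/omega_le => // x y; apply: le_trans.
have rh t : ((c * t)%:E <= rho f t)%E.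
  by apply: rho_ge => x y xy; apply: le_trans (fl x y); rewrite ler_pM2l.
split; split.
- by move=> t t0; rewrite (le_lt_trans (om t t0))// ltry.
- apply/cvgeyPge => A; near=> t; apply: le_trans (rh t); rewrite lee_fin.
  rewrite mulrC -ler_pdivrMr//; near: t; exact: nbhs_pinfty_ge.
- apply: (@squeeze_cvge _ _ _ _ (fun=> 0%E) _ EFin).
  + near=> t; have t0 : 0 <= t by [].
    by rewrite omega_ge0// om.
  + exact: cvg_cst.
  + by apply: cvg_EFin; [exact: nearW|exact: cvg_at_right_filter].
- by move=> t t0; apply: lt_le_trans (rh t); rewrite lte_fin mulr_gt0.
Unshelve. all: by end_near. Qed.

Lemma le1_2 (R : realType) : 1 <= 2 :> R. Proof. by rewrite ler1n. Qed.

Theorem corollary1p7 (R : realType) :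
  (forall (p q : R) (p1 : 1 <= p) (q1 : 1 <= q), p < q ->
     ~ exists f : ell q1 -> ell p1,
         [/\ weakly_seq_continuous f, coarse f & property_star f]) /\
  (exists X Y : completeNormedModType R,
     (exists f : X -> Y, coarse_embedding f) /\
     ~ exists f : X -> Y, coarse_embedding f /\ weakly_seq_continuous f) /\
  (exists X Y : completeNormedModType R,
     (exists f : X -> Y, uniform_embedding f) /\
     ~ exists f : X -> Y, uniform_embedding f /\ weakly_seq_continuous f).
Proof.
split.
  move=> p q p1 q1 pq [f [fw fc fs]].
  exact: (ell_no_weakly_seq_continuous pq fw fc fs).
pose T : pointedType := (bool * nat * nat)%type.
have lt12 : 1 < 2 :> R by rewrite ltr1n.
pose F := @aharoni R (ell (le1_2 R)) (ell_dense_seq (le1_2 R))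
  erefl (@ell_dense_seqP R 2 (le1_2 R)).
have [Fc Fu] : coarse_embedding F /\ uniform_embedding F.
  apply: (@lipschitz_coarse_embedding R _ _ F 24^-1).
  - by rewrite invr_gt0.
  - by move=> x y; exact: aharoni_lip.
  - by move=> x y; rewrite mulrC; exact: aharoni_expand.
split; exists (ell (le1_2 R)), (c0 R T); split.
- by exists F.
- by move=> [f [fe fw]]; exact: (c0_no_coarse_embedding lt12 fw fe).
- by exists F.
- by move=> [f [fe fw]]; exact: (c0_no_uniform_embedding lt12 fw fe).
Qed.
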